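(* Let $\eta$ be an $\mathbb{N}$-valued random variable with $\mathbf{P}[\eta\ge1]>0$. If $\mathbf{E}\,\eta<\infty$, then for any infinite connected undirected graph $\mathcal{G}$ all of whose vertices have finite degree, $p_c(\mathcal{G},\eta)\ge(\mathbf{E}\,\eta+1)^{-1}$.
   Context: Here $\mathbb{N}=\{0,1,2,\dots\}$. Frog model $\mathrm{FM}(\mathcal{G},p,\eta)$. Let $\mathcal{G}$ be an infinite connected undirected graph all of whose sites (vertices) have finite degree, with a fixed site $\mathbf{0}$ called the root; let $p\in[0,1]$ and let $\eta$ be a random variable with values in $\mathbb{N}$. Let $\{\eta(x)\}_{x}$, $\{(S^x_n(i))_{n\in\mathbb{N}}\}_{x,\,i\ge1}$, $\{\Xi^x_p(i)\}_{x,\,i\ge 1}$ be independent families of independent random variables, where $\eta(x)$ has the law of $\eta$, $(S^x_n(i))_n$ is a discrete-time simple random walk on $\mathcal{G}$ started from $x$, and $\mathbf{P}[\Xi^x_p(i)=k]=(1-p)p^{k-1}$, $k=1,2,\dots$ (for $p=1$, $\Xi^x_p(i)=\infty$, no death). Site $x$ initially contains $\eta(x)$ particles; at time $0$ all particles are sleeping except those at the root, which are active. If the particles of site $x$ are activated at time $T(x)$, the $i$-th of them ($1\le i\le\eta(x)$) is active and located at $S^x_n(i)$ at time $T(x)+n$ for $0\le n<\Xi^x_p(i)$, and then disappears. When an active particle visits a site, all sleeping particles there become active. Formally, $t(x,y)=\min_{1\le i\le\eta(x)}\min\{n<\Xi^x_p(i):S^x_n(i)=y\}$ for $x\ne y$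 ($\infty$ if there is no such $n$), and $T(x)=\inf\{t(x_0,x_1)+\dots+t(x_{m-1},x_m)\}$ over all finite sequences $\mathbf{0}=x_0,x_1,\dots,x_m=x$, with $T(\mathbf{0})=0$; $T(x)=\infty$ means that $x$ is never visited by active particles. The model survives if at every time there is at least one active particle; otherwise it dies out. The critical parameter is $p_c(\mathcal{G},\eta)=\inf\{p\in[0,1]:\mathbf{P}[\mathrm{FM}(\mathcal{G},p,\eta)\text{ survives}]>0\}$. *)

(* Defs.v *)
From HB Require Import structures.
From mathcomp Require Import all_boot all_order all_algebra finmap.
From mathcomp Require Import all_classical all_reals all_analysis.
From mathcomp Require Import measurable_realfun.

Set Implicit Arguments.
Unset Strict Implicit.
Unset Printing Implicit Defensive.

Import Order.TTheory GRing.Theory Num.Theory.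

Local Open Scope classical_set_scope.
Local Open Scope ring_scope.

Record lf_graph := LfGraph {
  site : choiceType ;
  adj : rel site ;
  adj_sym : symmetric adj ;
  adj_irrefl : irreflexive adj ;
  adj_connected : forall x y, exists s, path adj x s /\ last x s = y ;
  adj_locally_finite : forall x, finite_set [set y | adj x y] ;
  site_infinite : infinite_set [set: site]
}.

Definition degree (G : lf_graph) (x : site G) : nat :=
  #|` fset_set [set y | adj x y] |.

(* Mutual independence of a family (F i) of systems of events. *)
Definition mutually_independent (R : realType) (d : measure_display)
    (T : measurableType d) (P : probability T R)
    (I : choiceType) (F : I -> set (set T)) : Prop :=
  forall (J : {fset I}) (A : I -> set T),
    (forall i, i \in J -> F i (A i)) ->
    P (\bigcap_(i in [set` J]) A i) = (\prod_(i <- J) P (A i))%E.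

Section random_walk.
Context (R : realType) (d : measure_display) (T : measurableType d).
Variables (P : probability T R) (G : lf_graph).

Definition srw_step (x y : site G) : R :=
  if adj x y then (degree x)%:R^-1 else 0.

(* The chain rule P[S_0 = h_0, ..., S_n = h_n, S_(n+1) = y] =
   P[S_0 = h_0, ..., S_n = h_n] * P[S_(n+1) = y | S_n = h_n] avoids
   conditioning on null events. Sites carry the discrete sigma-algebra. *)
Definition is_srw (x : site G) (S : nat -> T -> site G) : Prop :=
  [/\ forall n (A : set (site G)), measurable (S n @^-1` A),
      P [set w | S 0 w = x] = 1%E &
      forall n (h : nat -> site G) (y : site G),
        P [set w | (forall k, (k <= n)%N -> S k w = h k) /\ S n.+1 w = y] =
        (P [set w | forall k, (k <= n)%N -> S k w = h k] *
           (srw_step (h n) y)%:E)%E].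

(* The sigma-algebra generated by a whole trajectory. *)
Definition sigma_walk (S : nat -> T -> site G) : set (set T) :=
  <<s [set B | exists n (A : set (site G)), B = S n @^-1` A] >>.

(* Geometric law on {1, 2, ...}, degenerate at +oo when p = 1. *)
Definition is_lifetime (p : R) (Xi : T -> \bar R) : Prop :=
  (forall k : nat,
     P [set w | Xi w = k.+1%:R%:E] = ((1 - p) * p ^+ k)%:E) /\
  (p = 1 -> P [set w | Xi w = +oo%E] = 1%E).

End random_walk.

(* A realization of the random input of FM(G, p, eta), where mu is the law of
   eta. The particles of a site are numbered from 0 instead of 1, so those
   initially at x are the i < fm_eta x w. *)
Record frog_model (R : realType) (G : lf_graph) (p : R)
    (mu : probability nat R) := FrogModel {
  fm_disp : measure_display ;
  fm_space : measurableType fm_disp ;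
  fm_prob : probability fm_space R ;
  fm_eta : site G -> {RV fm_prob >-> nat} ;
  fm_walk : site G -> nat -> nat -> fm_space -> site G ;
  fm_life : site G -> nat -> {RV fm_prob >-> \bar R} ;
  fm_etaP : forall x (A : set nat), distribution fm_prob (fm_eta x) A = mu A ;
  fm_walkP : forall x i, is_srw fm_prob x (fm_walk x i) ;
  fm_lifeP : forall x i, is_lifetime fm_prob p (fm_life x i) ;
  fm_indep : mutually_independent fm_prob
    (fun j : site G + (site G * nat + site G * nat) =>
       match j with
       | inl x => preimage_set_system [set: fm_space] (fm_eta x) measurable
       | inr (inl (x, i)) => sigma_walk (fm_walk x i)
       | inr (inr (x, i)) =>
           preimage_set_system [set: fm_space] (fm_life x i) measurable
       end)
}.

Section frog_dynamics.
Context (R : realType) (G : lf_graph) (p : R) (mu : probability nat R).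
Variables (M : frog_model G p mu) (root : site G).
Local Open Scope ereal_scope.

Definition hit_time (x : site G) (i : nat) (y : site G) (w : fm_space M) :
    \bar R :=
  ereal_inf [set n%:R%:E | n in
    [set n : nat | n%:R%:E < fm_life M x i w /\ fm_walk x i n w = y]].

Definition passage_time (x y : site G) (w : fm_space M) : \bar R :=
  \big[mine/+oo]_(i < fm_eta M x w) hit_time x i y w.

(* The sequence root = x_0, x_1, ..., x_m = x is encoded as root :: s;
   consecutive sites are distinct because t(x, y) is defined for x != y only.
   The empty s gives T(root) = 0. *)
Definition activation_time (x : site G) (w : fm_space M) : \bar R :=
  ereal_inf
    [set \sum_(t <- pairmap (fun a b => passage_time a b w) root s) t | s in
      [set s : seq (site G) |
        path (fun a b => a != b) root s /\ last root s = x]].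

Definition active_particle_at (m : nat) (w : fm_space M) : Prop :=
  exists (x : site G) (i n : nat),
    [/\ (i < fm_eta M x w)%N,
        n%:R%:E < fm_life M x i w &
        activation_time x w + n%:R%:E = m%:R%:E].

Definition survives : set (fm_space M) :=
  [set w | forall m : nat, active_particle_at m w].

End frog_dynamics.

Arguments survives {R G p mu} M root _.

(* The law of the model is determined by G, p and mu, so P[survival] does not
   depend on the realization M. The infimum is taken in \bar R. *)
Definition critical_parameter (R : realType) (G : lf_graph) (root : site G)
    (mu : probability nat R) : \bar R :=
  ereal_inf [set p%:E | p in
    [set p : R | 0 <= p <= 1 /\
      exists M : frog_model G p mu, (0 < fm_prob M (survives M root))%E]].

(* Main.v *)
(* First moment over activation chains, with mean := E eta.  If a particle is
   active at time m, then following the activations back to the root yields a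
   chain of particles (x_0, i_0), ..., (x_l, i_l) with x_0 = root, in which
   (x_j, i_j) lives long enough to wake up x_(j+1) after n_j >= 1 steps and the
   last particle is still alive n_l >= 0 steps after its activation, where
   n_0 + ... + n_l = m.  Cutting loops off a geodesic makes the x_j distinct, so
   the corresponding events are independent, and the probability of a chain is
   at most \prod_j P(eta > i_j) p ^ n_j P(S_(n_j) = x_(j+1)).  Summing over i_j
   gives a factor mean per particle, summing over x_(j+1) a factor at most 1,
   and summing over the times gives
     mean * p ^ m * \sum_l 'C(m, l) mean ^ l = mean * (p * (1 + mean)) ^ m,
   which tends to 0 when p * (1 + mean) < 1. *)
Require Import Defs.
From HB Require Import structures.
From mathcomp Require Import all_boot all_order all_algebra finmap.
From mathcomp Require Import all_classical all_reals all_analysis.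
From mathcomp Require Import measurable_realfun.

Set Implicit Arguments.
Unset Strict Implicit.
Unset Printing Implicit Defensive.

Import Order.TTheory GRing.Theory Num.Theory numFieldNormedType.Exports.

Local Open Scope classical_set_scope.
Local Open Scope ring_scope.

(** * Countability of sites and paths, and loops in paths *)

Lemma lf_graph_countable (G : lf_graph) : countable [set: site G].
Proof.
have [->|/set0P[x0 _]] := eqVneq [set: site G] set0; first exact: countable0.
(* [ball n] consists of the end points of walks of exactly [n] steps from [x0]: finite by local
   finiteness, and covering all sites together by connectedness. *)
pose ball := fix ball n : set (site G) :=
  if n is n'.+1 then \bigcup_(x in ball n') [set y | adj x y] else [set x0].
have ball_fin n : finite_set (ball n).
  elim: n => [|n IHn] /=; first exact: finite_set1.
  by apply: bigcup_finite => // x _; exact: adj_locally_finite.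
have ball_path s n x : ball n x -> path (@adj G) x s ->
    ball (n + size s)%N (last x s).
  elim: s n x => [|y s IHs] n x nx /=; first by rewrite addn0.
  move=> /andP[xy ys]; rewrite addnS -addSn; apply: IHs => //=.
  by exists x.
apply: (sub_countable _ (bigcup_countable (countableP [set: nat])
  (fun n _ => finite_set_countable (ball_fin n)))).
apply: subset_card_le => y _.
have [s [s_path <-]] := adj_connected x0 y.
by exists (size s) => //; rewrite -[size s]add0n; exact: ball_path.
Qed.

(** Makes the infimum over paths in [activation_time] a countable one. *)
Lemma seq_countable (X : choiceType) : countable [set: X] ->
  countable [set: seq X].
Proof.
move=> /countable_injP[f f_inj].
have finj : injective f by move=> x y; apply: f_inj; rewrite inE.
apply/countable_injP; exists (fun s => choice.pickle (map f s)) => s t _ _.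
by move=> /(pcan_inj choice.pickleK)/(inj_map finj).
Qed.

(** Either [x] recurs in [s], and the loop runs up to that occurrence, or the repetition lies in the
    tail. Deleting [s2] keeps the end point of the path. *)
Lemma nonuniq_loop (X : eqType) (x : X) (s : seq X) : ~~ uniq (x :: s) ->
  exists s1 s2 s3, [/\ s = s1 ++ s2 ++ s3, s2 != [::] &
    last (last x s1) s2 = last x s1].
Proof.
elim: s x => [//|y s IHs] x; rewrite [uniq _]/=.
have [xs _|xs] := boolP (x \in y :: s).
  case/splitPr: xs => p1 p2; exists [::], (rcons p1 x), p2.
  by rewrite /= cat_rcons last_rcons; split => //; case: p1.
rewrite /= => /IHs[s1 [s2 [s3 [-> s2N s2l]]]].
by exists (y :: s1), s2, s3.
Qed.

(** * Independence of an event from the inputs not yet used *)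

Section independence.
Context {R : realType} {d : measure_display} {T : measurableType d}.
Variables (P : probability T R) (I : choiceType) (F : I -> set (set T)).

(* B is independent of all the systems with index outside D; this is what lets
   a chain be extended one particle at a time. *)
Definition indep_outside (D : set I) (B : set T) : Prop :=
  measurable B /\
  forall (J : {fset I}) (A : I -> set T),
    (forall i, i \in J -> ~ D i /\ F i (A i)) ->
    P (B `&` \bigcap_(i in [set` J]) A i) =
    (P B * \prod_(i <- J) P (A i))%E.

Lemma indep_outsideS (D D' : set I) B : D `<=` D' ->
  indep_outside D B -> indep_outside D' B.
Proof.
move=> DD' [mB indB]; split=> // J A JA; apply: indB => i /JA[nD FA].
by split=> // /DD'.
Qed.

Lemma indep_outsideT : mutually_independent P F -> indep_outside set0 setT.
Proof.
move=> indF; split=> // J A JA; rewrite setTI probability_setT mul1e.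
by apply: indF => i /JA[].
Qed.

(** Independence over the singleton of [j] identifies the product [P B * P A0]; independence over
    [J] with [j] added then splits off the remaining factors. *)
Lemma indep_outsideI D B j A0 : indep_outside D B -> ~ D j -> F j A0 ->
  measurable A0 ->
  indep_outside (j |` D) (B `&` A0) /\ P (B `&` A0) = (P B * P A0)%E.
Proof.
move=> [mB indB] Dj FA mA.
have PBA : P (B `&` A0) = (P B * P A0)%E.
  have := indB [fset j]%fset (fun=> A0).
  rewrite set_fset1 bigcap_set1 big_seq_fset1; apply.
  by move=> i; rewrite inE => /eqP ->.
split=> //; split=> [|J A JA]; first exact: measurableI.
have jJ : j \notin J by apply/negP => /JA[+ _]; apply; left.
pose A' i := if i == j then A0 else A i.
have A'J i : i \in J -> A' i = A i.
  by move=> iJ; rewrite /A' ifN//; apply: contra jJ => /eqP <-.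
have /indB : forall i, i \in (j |` J)%fset -> ~ D i /\ F i (A' i).
  move=> i; rewrite !inE => /predU1P[->|iJ]; first by rewrite /A' eqxx.
  have [Di FAi] := JA _ iJ; rewrite A'J//; split => //.
  by move=> Di'; apply: Di; right.
have A'j : A' j = A0 by rewrite /A' eqxx.
have capE : \bigcap_(i in [set` J]) A' i = \bigcap_(i in [set` J]) A i.
  by apply: eq_bigcapr => i /= /A'J.
have prodE : (\prod_(i <- J) P (A' i) = \prod_(i <- J) P (A i))%E.
  by apply: eq_big_seq => i /A'J ->.
by rewrite big_fsetU1//= set_fsetU1 bigcap_setU1 setIA A'j capE prodE muleA
  -PBA.
Qed.

End independence.

(** Union bound for the [F i], then additivity for the disjoint [D i]. With [D y] recording the
    position [y] of a walk, the choice of the next site costs a factor at most 1 without computing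
    any transition probability. *)
Lemma measure_countable_bigcup_le {R : realType} {d : measure_display}
    {T : measurableType d} (P : {measure set T -> \bar R}) (I : Type)
    (F D : I -> set T) (A : set T) (c : R) : countable [set: I] -> 0 <= c ->
  (forall i, measurable (F i)) -> (forall i, measurable (D i)) ->
  measurable A -> trivIset setT D -> (forall i, D i `<=` A) ->
  (forall i, P (F i) <= c%:E * P (D i))%E ->
  (P (\bigcup_i F i) <= c%:E * P A)%E.
Proof.
move=> /countable_injP[g g_inj] c0 mF mD mA tD DA FD.
(* Reindexing along the injection [g] gives series over [nat]; a fiber is a single [E i], or empty
   off the range of [g]. *)
pose fiber (E : I -> set T) k := \bigcup_(i in [set i | g i = k]) E i.
have fiberE k : (exists i, forall E, fiber E k = E i) \/
    (forall E, fiber E k = set0).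
  have [[i gi]|nk] := pselect (exists i, g i = k); [left|right].
    exists i => E; rewrite (_ : fiber E k = \bigcup_(j in [set i]) E j).
      by rewrite bigcup_set1.
    apply: eq_bigcupl; split => j /=; last by move=> ->.
    by rewrite -gi => /g_inj -> //; rewrite inE.
  by move=> E; rewrite -subset0 => t [i gi _]; apply: nk; exists i.
have fiber_cup E : \bigcup_i E i = \bigcup_k fiber E k.
  by apply/seteqP; split=> [t [i _ ?]|t [_ _ [i _ ?]]];
    [exists (g i) => //; exists i|exists i].
have mfiber E : (forall i, measurable (E i)) ->
    forall k, measurable (fiber E k).
  by move=> mE k; case: (fiberE k) => [[i ->]|->].
rewrite fiber_cup; apply: (le_trans (generalized_Boole_inequality _ _ _)).
- exact: mfiber.
- by apply: bigcupT_measurable; exact: mfiber.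
apply: (@le_trans _ _ (\sum_(0 <= k <oo) c%:E * P (fiber D k))%E).
  apply: lee_nneseries => // k _.
  by case: (fiberE k) => [[i E]|E]; rewrite !E// !measure0 mule0.
rewrite nneseriesZl//; apply: lee_wpmul2l; first by rewrite lee_fin.
have -> : (\sum_(0 <= k <oo) P (fiber D k) = P (\bigcup_k fiber D k))%E.
  rewrite measure_bigcup//; last 2 first.
  - by move=> k _; exact: mfiber.
  - move=> k l _ _ [t [[i gi Dit] [j gj Djt]]]; rewrite -gi -gj.
    by congr g; apply: tD => //; exists t.
  by apply: eq_eseriesl => k; rewrite in_setT.
apply: le_measure; rewrite ?inE//.
  by apply: bigcupT_measurable; exact: mfiber.
by move=> t [k _ [i _ /DA]].
Qed.

(** * Activation chains and their measurability *)

Section activation_chains.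
Context {R : realType} {G : lf_graph} {p : R} {mu : probability nat R}.
Variable M : frog_model G p mu.
Hypothesis p0 : 0 <= p.
Notation Omega := (fm_space M).
Notation PM := (fm_prob M).

Definition has_particle (x : site G) (i : nat) : set Omega :=
  [set w | (i < fm_eta M x w)%N].

Definition outlives (x : site G) (i n : nat) : set Omega :=
  [set w | (n%:R%:E < fm_life M x i w)%E].

Definition walks_to (x : site G) (i n : nat) (y : site G) : set Omega :=
  [set w | fm_walk x i n w = y].

(* The event that some activation chain starting with a particle of x, using no
   site twice and none of X after x, has total duration m.  The recursion is on
   the number of further particles, at most fuel; fuel = m loses nothing because
   each particle but the last takes n.+1 > 0 steps. *)
Fixpoint chains (fuel : nat) (X : seq (site G)) (x : site G) (m : nat) :
    set Omega :=
  \bigcup_i (has_particle x i `&` outlives x i m) `|`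
  if fuel is f.+1 then
    \big[setU/set0]_(n < m) \bigcup_i \bigcup_(y in [set y | y \notin x :: X])
      (has_particle x i `&` outlives x i n.+1 `&` walks_to x i n.+1 y `&`
       chains f (x :: X) y (m - n.+1))
  else set0.

Lemma measurable_has_particle x i : measurable (has_particle x i).
Proof.
rewrite -[has_particle x i]setTI.
exact: (measurable_funP (fm_eta M x) _ [set k | (i < k)%N]).
Qed.

Lemma measurable_outlives x i n : measurable (outlives x i n).
Proof.
rewrite (_ : outlives x i n = fm_life M x i @^-1` `]n%:R%:E, +oo[).
  rewrite -[X in measurable X]setTI.
  apply: (measurable_funP (fm_life M x i)) => //.
  exact: emeasurable_itv.
by rewrite preimage_itvoy.
Qed.

Lemma measurable_walks_to x i n y : measurable (walks_to x i n y).
Proof. by have [mS _ _] := fm_walkP M x i; exact: (mS n [set y]). Qed.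

Lemma measurable_chains fuel X x m : measurable (chains fuel X x m).
Proof.
elim: fuel X x m => [|fuel IHf] X x m /=; apply: measurableU => //.
1,2: apply: bigcupT_measurable => i; apply: measurableI.
1,3: exact: measurable_has_particle.
1,2: exact: measurable_outlives.
apply: bigsetU_measurable => n _; apply: bigcupT_measurable => i.
rewrite bigcup_mkcond; apply: countable_bigcupT_measurable.
  exact: lf_graph_countable.
move=> y; case: ifPn => // _; apply: measurableI => //.
apply: measurableI; last exact: measurable_walks_to.
by apply: measurableI;
  [exact: measurable_has_particle|exact: measurable_outlives].
Qed.

(** * First moment bound for chains *)

Lemma prob_has_particle x i : PM (has_particle x i) = mu [set k | (i < k)%N].
Proof. by rewrite -(fm_etaP M x). Qed.

(** The lifetimes 1, ..., [n] are excluded, and these disjoint events have total probability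
    [1 - p ^+ n]. *)
Lemma prob_outlives_le x i n : (PM (outlives x i n) <= (p ^+ n)%:E)%E.
Proof.
have [lifeP _] := fm_lifeP M x i.
pose dies k : set Omega := [set w | fm_life M x i w = k.+1%:R%:E].
have mdies k : measurable (dies k).
  rewrite -[dies k]setTI.
  exact: (measurable_funP (fm_life M x i) measurableT [set k.+1%:R%:E]).
have tdies : trivIset setT dies.
  move=> k l _ _ [w []]; rewrite /dies /= => -> [] /eqP.
  by rewrite eqr_nat eqSS => /eqP.
have disj : [disjoint outlives x i n & \big[setU/set0]_(k < n) dies k].
  rewrite disj_set2E; apply/eqP; rewrite -subset0 => w [].
  rewrite /outlives /= -bigcup_mkord => nw [k /= kn]; rewrite /dies /= => wk.
  by move: nw; rewrite wk lte_fin ltr_nat ltnS leqNgt kn.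
have mU : measurable (\big[setU/set0]_(k < n) dies k).
  exact: bigsetU_measurable.
have := probability_le1 PM (measurableU _ _ (measurable_outlives x i n) mU).
rewrite measureU//; [|exact: measurable_outlives|exact/disj_set2P].
rewrite measure_bigsetU//=.
rewrite (eq_bigr (fun k : 'I_n => ((1 - p) * p ^+ k)%:E)); last first.
  by move=> k _; exact: lifeP.
rewrite sumEFin -mulr_sumr -opprB mulNr -subrX1 opprB.
by rewrite -leeBrDr// -EFinB opprB addrC subrK.
Qed.

Definition input_index : choiceType :=
  (site G + (site G * nat + site G * nat))%type.

Definition input_events (j : input_index) : set (set Omega) :=
  match j with
  | inl x => preimage_set_system [set: Omega] (fm_eta M x) measurable
  | inr (inl (x, i)) => sigma_walk (@fm_walk _ _ _ _ M x i)
  | inr (inr (x, i)) =>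
      preimage_set_system [set: Omega] (fm_life M x i) measurable
  end.

Definition index_site (j : input_index) : site G :=
  match j with
  | inl x => x
  | inr (inl (x, _)) => x
  | inr (inr (x, _)) => x
  end.

(** All inputs of a site are discarded at once, since a chain never returns to a site. *)
Definition indep_away (X : seq (site G)) : set Omega -> Prop :=
  indep_outside PM input_events [set j | index_site j \in X].

(** The particle number, the lifetime and the walk of [x] are adjoined to [B] in turn. The bound
    leaves out the walk, whose positions are handled by disjointness. *)
Lemma indep_away_particle X B x i n y : x \notin X -> indep_away X B ->
  indep_away (x :: X)
    (B `&` has_particle x i `&` outlives x i n `&` walks_to x i n y) /\
  (PM (B `&` has_particle x i `&` outlives x i n) <=
   PM B * mu [set k | (i < k)%N] * (p ^+ n)%:E)%E.
Proof.
move=> xX indB.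
have [ind1 P1] := indep_outsideI (j := inl x) indB (negP xX)
  (ex_intro2 _ _ [set k | (i < k)%N] I (setTI _)) (measurable_has_particle x i).
have [|||ind2 P2] := indep_outsideI (j := inr (inr (x, i)))
    (A0 := outlives x i n) ind1.
- by case=> //; exact: (negP xX).
- exists `]n%:R%:E, +oo[%classic; first exact: emeasurable_itv.
  by rewrite setTI preimage_itvoy.
- exact: measurable_outlives.
have [|||ind3 _] := indep_outsideI (j := inr (inl (x, i)))
    (A0 := walks_to x i n y) ind2.
- by case=> // -[] //; exact: (negP xX).
- by apply: sub_sigma_algebra; exists n, [set y].
- exact: measurable_walks_to.
split.
  apply: indep_outsideS ind3 => j [->|[->|[->|]]] /=; rewrite inE ?eqxx//.
  by move=> ->; rewrite orbT.
rewrite P2 P1 prob_has_particle; apply: lee_wpmul2l.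
  exact: mule_ge0.
exact: prob_outlives_le.
Qed.

Variable mean : R.
Hypothesis mean_ge0 : 0 <= mean.
Hypothesis tail_sum : (\sum_(0 <= i <oo) mu [set k | (i < k)%N] <= mean%:E)%E.

(** Summing over the particle number [i] turns the tails of [mu] into one factor [mean]. *)
Lemma prob_bigcup_particles X B x n (F : nat -> set Omega) (c : R) :
  x \notin X -> indep_away X B -> 0 <= c -> (forall i, measurable (F i)) ->
  (forall i,
    PM (F i) <= c%:E * PM (B `&` has_particle x i `&` outlives x i n))%E ->
  (PM (\bigcup_i F i) <= (c * p ^+ n * mean)%:E * PM B)%E.
Proof.
move=> xX indB c0 mF Fle.
have mB : measurable B by case: indB.
have pn0 : 0 <= p ^+ n by exact: exprn_ge0.
have PB : PM B = (fine (PM B))%:E by rewrite fineK// fin_num_measure.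
apply: (le_trans (generalized_Boole_inequality _ mF (bigcupT_measurable _ mF))).
apply: (@le_trans _ _ (\sum_(0 <= i <oo)
    (c * p ^+ n * fine (PM B))%:E * mu [set k | (i < k)%N])%E).
  apply: lee_nneseries => // i _; apply: (le_trans (Fle i)).
  have [_ le1] := indep_away_particle i n x xX indB.
  apply: (le_trans (lee_wpmul2l _ le1)); first by rewrite lee_fin.
  rewrite !EFinM -PB -!muleA [in leRHS](muleCA _ (PM B)).
  by rewrite [X in (c%:E * (PM B * X))%E]muleC.
rewrite nneseriesZl//.
have -> : ((c * p ^+ n * mean)%:E * PM B =
    (c * p ^+ n * fine (PM B))%:E * mean%:E)%E.
  by rewrite [in LHS]PB -!EFinM mulrAC.
by apply: lee_wpmul2l => //; rewrite lee_fin !mulr_ge0// fine_ge0.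
Qed.

(** [B] is the past of the chain. It is arbitrary so that the induction hypothesis applies to [B]
    enlarged by the step of a particle of [x], an event independent of all sites outside
    [x :: X]. *)
Lemma prob_chains_le fuel X x m B : x \notin X -> indep_away X B ->
  (PM (B `&` chains fuel X x m) <= (mean * (p * (1 + mean)) ^+ m)%:E * PM B)%E.
Proof.
elim: fuel X x m B => [|fuel IHf] X x m B xX indB.
all: have mB : measurable B by case: indB.
all: have PB0 : (0 <= PM B)%E by [].
all: have mEL n i : measurable (has_particle x i `&` outlives x i n)
  by apply: measurableI; [exact: measurable_has_particle
                         |exact: measurable_outlives].
all: have last_le : (PM (B `&` \bigcup_i (has_particle x i `&` outlives x i m))
    <= (mean * p ^+ m)%:E * PM B)%E
  by rewrite setI_bigcupr -[mean * _]mulrC -[p ^+ m]mul1r;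
     apply: (prob_bigcup_particles xX indB) => // [i|i];
     [exact: measurableI|rewrite mul1e setIA].
  (* With no further particle the factor is [mean * p ^+ m], and [1 + mean] is at least 1. *)
  rewrite /= setU0; apply: (le_trans last_le); apply: lee_wpmul2r => //.
  rewrite lee_fin exprMn ler_wpM2l// ler_peMr ?exprn_ge0//.
  by rewrite exprn_ege1// lerDl.
pose step n i y := has_particle x i `&` outlives x i n.+1 `&`
  walks_to x i n.+1 y `&` chains fuel (x :: X) y (m - n.+1).
have mstep n i y : measurable (step n i y).
  apply: measurableI; last exact: measurable_chains.
  by apply: measurableI => //; exact: measurable_walks_to.
have mstepy n i :
    measurable (\bigcup_(y in [set y | y \notin x :: X]) step n i y).
  rewrite bigcup_mkcond; apply: countable_bigcupT_measurable.
    exact: lf_graph_countable.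
  by move=> y; case: ifPn.
have step_le n : (n < m)%N ->
    (PM (B `&` \bigcup_i \bigcup_(y in [set y | y \notin x :: X]) step n i y) <=
    (mean * (p * (1 + mean)) ^+ (m - n.+1) * p ^+ n.+1 * mean)%:E * PM B)%E.
  move=> nm; rewrite setI_bigcupr.
  apply: (prob_bigcup_particles xX indB) => [|i|i].
  - by rewrite mulr_ge0// exprn_ge0// mulr_ge0// addr_ge0.
  - exact: measurableI.
  (* These events are disjoint in [y], as a walk is at one site at a time. *)
  pose D y := B `&` has_particle x i `&` outlives x i n.+1 `&`
    walks_to x i n.+1 y.
  have mD y : measurable (D y).
    have [+ _] := indep_away_particle i n.+1 y xX indB.
    by case.
  rewrite setI_bigcupr bigcup_mkcond.
  apply: (measure_countable_bigcup_le (D := D)) => //.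
  - exact: lf_graph_countable.
  - by rewrite mulr_ge0// exprn_ge0// mulr_ge0// addr_ge0.
  - by move=> y; case: ifPn => // _; exact: measurableI.
  - by rewrite -setIA; exact: measurableI.
  - by move=> y z _ _ [w [[_ <-] [_ <-]]].
  - by move=> y; exact: subIsetl.
  move=> y; case: ifPn => [|_]; last first.
    rewrite measure0 mule_ge0// lee_fin.
    by rewrite mulr_ge0// exprn_ge0// mulr_ge0// addr_ge0.
  rewrite inE /= => yX.
  have [indD _] := indep_away_particle i n.+1 y xX indB.
  by have := IHf _ _ (m - n.+1)%N _ yX indD; rewrite /step !setIA.
have mcup n : measurable
    (\bigcup_i \bigcup_(y in [set y | y \notin x :: X]) step n i y).
  by apply: bigcupT_measurable => i; exact: mstepy.
rewrite /= setIUr; apply: (le_trans (measureU2 _ _ _)).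
- by apply: measurableI => //; exact: bigcupT_measurable.
- by apply: measurableI => //; apply: bigsetU_measurable => n _; exact: mcup.
rewrite (big_morph _ (setIUr B) (setI0 B)).
pose Q n := B `&` \bigcup_i \bigcup_(y in [set y | y \notin x :: X]) step n i y.
have boole : (PM (\big[setU/set0]_(n < m) Q n) <= \sum_(n < m) PM (Q n))%E.
  by apply: Boole_inequality => n _; exact: measurableI.
apply: (le_trans (leeD last_le boole)).
apply: (le_trans (leeD (le_refl _) (lee_sum _ (fun (n : 'I_m) _ =>
   step_le n (ltn_ord n))))).
rewrite -ge0_sume_distrl; last first.
  by move=> n _; rewrite lee_fin !mulr_ge0// ?exprn_ge0// mulr_ge0// addr_ge0.
rewrite sumEFin -ge0_muleDl//; last 2 first.
  by rewrite lee_fin mulr_ge0// exprn_ge0.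
  rewrite lee_fin sumr_ge0// => n _.
  by rewrite !mulr_ge0// ?exprn_ge0// mulr_ge0// addr_ge0.
(* mean + mean ^ 2 * \sum_(n < m) (1 + mean) ^ (m - n.+1) is a geometric sum
   equal to mean * (1 + mean) ^ m. *)
apply: lee_wpmul2r => //; rewrite lee_fin le_eqVlt; apply/orP; left; apply/eqP.
rewrite (eq_bigr (fun n : 'I_m => mean * p ^+ m *
    (mean * (1 + mean) ^+ rev_ord n))); last first.
  move=> n _; rewrite /= exprMn.
  rewrite -[in p ^+ m](subnK (ltn_ord n)) exprD.
  move: (p ^+ n.+1) (p ^+ _) (_ ^+ _) => a b c.
  by rewrite -!mulrA; do 2!congr (_ * _); rewrite mulrC -mulrA.
rewrite -!mulr_sumr.
have -> : \sum_(n < m) (1 + mean) ^+ rev_ord n = \sum_(n < m) (1 + mean) ^+ n.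
  by rewrite [RHS](reindex_inj rev_ord_inj).
rewrite -[X in X * \sum_(_ < _) _](addrK 1 mean) [mean + 1]addrC -subrX1.
by rewrite exprMn mulrA -[X in X + _]mulr1 -mulrDr [1 + (_ - _)]addrC subrK.
Qed.

(** * Measurability of the passage and activation times *)

Lemma measurable_fun_of_lt (f : Omega -> \bar R) :
  (forall r : R, measurable [set w | (f w < r%:E)%E]) ->
  measurable_fun setT f.
Proof.
move=> mf; apply: (measurability _ (ErealGenInftyO.measurableE R)).
by move=> _ /= [_ [r ->] <-]; rewrite setTI preimage_itvNyo; exact: mf.
Qed.

Lemma measurable_hit_time x i y :
  measurable_fun setT (fun w : Omega => hit_time x i y w).
Proof.
apply: measurable_fun_of_lt => r.
rewrite (_ : mkset _ = \bigcup_(n in [set n | n%:R < r])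
    (outlives x i n `&` walks_to x i n y)).
  apply: bigcup_measurable => n _.
  by apply: measurableI;
    [exact: measurable_outlives|exact: measurable_walks_to].
apply/seteqP; split=> w /=.
  move=> /ereal_inf_ltP[_ [n /= [nl nw] <-]].
  by rewrite lte_fin => nr; exists n.
move=> [n /= nr [nl nw]].
by apply/ereal_inf_ltP; exists n%:R%:E; [exists n|rewrite lte_fin].
Qed.

Lemma measurable_passage_time x y :
  measurable_fun setT (fun w : Omega => passage_time x y w).
Proof.
apply: measurable_fun_of_lt => r.
rewrite (_ : mkset _ =
    \bigcup_i (has_particle x i `&` [set w | (hit_time x i y w < r%:E)%E])).
  apply: bigcupT_measurable => i; apply: measurableI.
    exact: measurable_has_particle.
  have := measurable_hit_time x i y measurableT (emeasurable_itv `]-oo, r%:E[).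
  by rewrite setTI preimage_itvNyo.
apply/seteqP; split=> [w /= /bigmin_ltP[|[i _ ir]]|w [i _ [ix ir]]].
- by rewrite ltNge leey.
- by exists i => //; split => //; exact: ltn_ord.
- by apply/bigmin_ltP; right; exists (Ordinal ix).
Qed.

Lemma measurable_path_time x (s : seq (site G)) :
  measurable_fun setT (fun w : Omega =>
    (\sum_(t <- pairmap (fun a b => passage_time a b w) x s) t)%E).
Proof.
elim: s x => [|y s IHs] x.
  by under eq_fun do rewrite big_nil; exact: measurable_cst.
under eq_fun do rewrite /= big_cons.
by apply: emeasurable_funD; [exact: measurable_passage_time|exact: IHs].
Qed.

Lemma measurable_activation_time root x :
  measurable_fun setT (fun w : Omega => activation_time root x w).
Proof.
apply: measurable_fun_of_lt => r.
pose path_lt s : set Omega :=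
  [set w |
    (\sum_(t <- pairmap (fun a b => passage_time a b w) root s) t < r%:E)%E].
pose to_x s := path (fun a b : site G => a != b) root s && (last root s == x).
rewrite (_ : mkset _ = \bigcup_(s in [set s | to_x s]) path_lt s).
  rewrite bigcup_mkcond; apply: countable_bigcupT_measurable.
    exact/seq_countable/lf_graph_countable.
  move=> s; case: ifPn => // _.
  have := measurable_path_time root s measurableT
    (emeasurable_itv `]-oo, r%:E[).
  by rewrite setTI preimage_itvNyo.
apply/seteqP; split=> [w /= /ereal_inf_ltP[_ [s /= [sp sl] <-] sr]|].
  by exists s => //=; rewrite /to_x sp sl eqxx.
move=> w [s /= /andP[sp /eqP sl] sr]; apply/ereal_inf_ltP.
by eexists; [exists s; [split|reflexivity]|].
Qed.

(* Needed because the value of PM on a non-measurable set is arbitrary. *)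
Lemma measurable_survives root : measurable (survives M root).
Proof.
rewrite (_ : survives M root = \bigcap_m \bigcup_x \bigcup_i \bigcup_n
  (has_particle x i `&` outlives x i n `&`
   [set w | (activation_time root x w + n%:R%:E)%E = m%:R%:E])).
  apply: bigcapT_measurable => m; apply: countable_bigcupT_measurable.
    exact: lf_graph_countable.
  move=> x; apply: bigcupT_measurable => i; apply: bigcupT_measurable => n.
  apply: measurableI; first apply: measurableI.
  - exact: measurable_has_particle.
  - exact: measurable_outlives.
  have mT : measurable_fun setT
      (fun w : Omega => activation_time root x w + n%:R%:E)%E.
    by apply: emeasurable_funD => //; exact: measurable_activation_time.
  have := mT measurableT [set m%:R%:E].
  by rewrite setTI; apply.
apply/seteqP; split=> [w Sw m _|w Sw m].
  have [x [i [n [ix nl Tm]]]] := Sw m.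
  by exists x => //; exists i => //; exists n.
have [x _ [i _ [n _ [[ix nl] Tm]]]] := Sw m I.
by exists x, i, n.
Qed.

(** * From survival to activation chains *)

Lemma hit_time_attained x i y (w : Omega) : (hit_time x i y w < +oo)%E ->
  exists n, [/\ outlives x i n w, walks_to x i n y w &
    hit_time x i y w = n%:R%:E].
Proof.
move=> /ereal_inf_ltP[_ [n0 /= hit0 _] _].
have ex : exists n, `[< outlives x i n w /\ walks_to x i n y w >].
  by exists n0; apply/asboolP.
case: (ex_minnP ex) => n /asboolP[nl nw] nmin; exists n; split=> //.
apply/eqP; rewrite eq_le; apply/andP; split.
  by apply: ereal_inf_lbound; exists n.
apply: le_ereal_inf_tmp => _ [l /= hit <-].
by rewrite lee_fin ler_nat; apply: nmin; apply/asboolP.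
Qed.

Lemma passage_time_attained x y (w : Omega) : (passage_time x y w < +oo)%E ->
  exists i n, [/\ has_particle x i w, outlives x i n w, walks_to x i n y w &
    passage_time x y w = n%:R%:E].
Proof.
move=> fin.
suff [E|//] : passage_time x y w = +oo%E \/ exists i n,
    [/\ has_particle x i w, outlives x i n w, walks_to x i n y w &
    passage_time x y w = n%:R%:E] by rewrite E ltxx in fin.
rewrite {fin} /passage_time; elim/big_ind: _ => [|a b ha hb|i _]; first by left.
  by rewrite minEle; case: ifP.
have [E|] := eqVneq (hit_time x i y w) +oo%E; first by left.
rewrite -ltey => /hit_time_attained[n [nl nw hn]]; right.
by exists i, n; split=> //; exact: ltn_ord.
Qed.

Lemma passage_time_ge0 x y (w : Omega) : (0 <= passage_time x y w)%E.
Proof.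
have [->//|] := eqVneq (passage_time x y w) +oo%E.
by rewrite -ltey => /passage_time_attained[i [n [_ _ _ ->]]]; rewrite lee_fin.
Qed.

Notation path_time w x s :=
  (\sum_(t <- pairmap (fun a b => passage_time a b w) x s) t)%E.

Lemma path_time_ge0 x s (w : Omega) : (0 <= path_time w x s)%E.
Proof.
elim: s x => [|y s IHs] x; first by rewrite big_nil.
by rewrite /= big_cons adde_ge0// passage_time_ge0.
Qed.

(** Passage times are nonnegative, so cutting out a loop does not increase the total; strong
    induction on the length. *)
Lemma path_time_uniq x s (w : Omega) : exists s',
  [/\ uniq (x :: s'), last x s' = last x s &
      (path_time w x s' <= path_time w x s)%E].
Proof.
have [n] := ubnP (size s); elim: n s => // n IHn s sn.
have [us|] := boolP (uniq (x :: s)); first by exists s.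
move=> /nonuniq_loop[s1 [s2 [s3 [sE s2N s2l]]]].
have [|s' [us' ls' ts']] := IHn (s1 ++ s3).
  move: sn; rewrite ltnS; apply: leq_trans.
  by rewrite sE !size_cat ltn_add2l -[ltnLHS]add0n ltn_add2r lt0n size_eq0.
exists s'; split=> //; first by rewrite ls' sE !last_cat s2l.
apply: (le_trans ts'); rewrite sE !pairmap_cat !big_cat/= s2l.
by rewrite leeD2l// leeDr// path_time_ge0.
Qed.

(** The particles attaining the successive passage times form the chain. Fuel [k + n] suffices
    because each passage takes at least one step. *)
Lemma path_time_chains x s X (w : Omega) :
  (forall z j, walks_to z j 0 z w) -> uniq (x :: s) ->
  all (fun z => z \notin X) s -> (path_time w x s < +oo)%E ->
  exists2 k, path_time w x s = k%:R%:E &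
    forall i n fuel, (k + n <= fuel)%N -> has_particle (last x s) i w ->
      outlives (last x s) i n w -> chains fuel X x (k + n) w.
Proof.
move=> start; elim: s x X => [|y s IHs] x X.
  move=> _ _ _; exists 0; first by rewrite big_nil.
  by move=> i n [|fuel] _ ix il; left; exists i.
rewrite [path_time _ _ _]big_cons => /= /andP[xys us] /andP[yX sX] fin.
have rest0 := path_time_ge0 y s w.
have pass0 := passage_time_ge0 x y w.
have [i1 [n1 [ix1 il1 iw1 pass]]] :
    exists i n, [/\ has_particle x i w, outlives x i n w, walks_to x i n y w &
    passage_time x y w = n%:R%:E].
  by apply: passage_time_attained; apply: le_lt_trans fin; rewrite leeDl.
have [||k rest IHk] := IHs y (x :: X) us.
- apply/allP => z zs; rewrite inE negb_or (allP sX _ zs) andbT.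
  by apply: contraNneq xys => <-; rewrite inE zs orbT.
- by apply: le_lt_trans fin; rewrite leeDr.
exists (n1 + k)%N; first by rewrite pass rest -EFinD natrD.
(* A passage in zero steps would give [y = x] by [start], against the distinctness of the sites. *)
move=> i n fuel; case: n1 {pass} il1 iw1 => [|n1] il1 iw1.
  by move: xys; rewrite -(iw1 : _ = y) (start x i1 : _ = x) mem_head.
case: fuel => [//|fuel] le_fuel ix il.
have n1_lt : (n1 < n1.+1 + k + n)%N by rewrite !addSn ltnS -addnA leq_addr.
right; rewrite (bigD1 (Ordinal n1_lt))//=; left.
exists i1 => //; exists y.
  rewrite /= inE negb_or yX andbT; apply: contraNneq xys => ->.
  exact: mem_head.
split; first by [].
rewrite -addnA addKn; apply: IHk ix il.
move: le_fuel; rewrite !addSn ltnS -addnA; apply: leq_trans.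
by rewrite leq_addl.
Qed.

Lemma survives_chains root (w : Omega) m :
  (forall z j, walks_to z j 0 z w) -> survives M root w ->
  chains m [::] root m w.
Proof.
move=> start /(_ m)[x [i [n [ix il]]]].
case T_eq : (activation_time root x w) => [t| |]//= -[tn].
(* A path within 1 of the infimum is enough: after removal of loops its time is an integer [k] with
   [t <= k < t + 1], and [t = m - n] is an integer too, so [k = t]. *)
have /ereal_inf_ltP[_ [s /= [_ sl] <-] s_lt] :
  (activation_time root x w < (t + 1)%:E)%E by rewrite T_eq lte_fin ltrDl.
have [s' [us' sl' s'_le]] := path_time_uniq root s w.
have s'_lt := le_lt_trans s'_le s_lt.
have [|k s'k s'chains] := path_time_chains (X := [::]) start us' (all_predT _).
  by apply: lt_trans s'_lt _; rewrite ltey.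
have t_le : (activation_time root x w <= k%:R%:E)%E.
  rewrite -s'k; apply: ereal_inf_lbound; exists s' => //; split; last first.
    by rewrite sl'.
  by have := us'; rewrite uniq_pairwise => /pairwise_sorted.
move: t_le s'_lt; rewrite T_eq s'k lee_fin lte_fin => t_le k_lt.
have -> : m = (k + n)%N.
  apply/eqP; rewrite eqn_leq -[(k + n <= m)%N]ltnS.
  rewrite -(ler_nat R) -(ltr_nat R) -[m.+1]addn1 !natrD -tn.
  by rewrite lerD2r t_le addrAC ltrD2r k_lt.
by apply: (s'chains i); rewrite ?sl' ?sl.
Qed.

(** * Almost sure extinction for small [p] *)

Lemma survives_null root : p * (1 + mean) < 1 -> PM (survives M root) = 0%E.
Proof.
move=> q1; set q := p * (1 + mean) in q1.
have q0 : 0 <= q by rewrite mulr_ge0// addr_ge0.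
(* A walk starts at its site only almost surely. *)
pose bad (zj : site G * nat) := ~` walks_to zj.1 zj.2 0 zj.1.
have mbad zj : measurable (bad zj).
  by apply: measurableC; exact: measurable_walks_to.
have ctbl : countable [set: site G * nat].
  by rewrite -setXTT; apply: countableX => //; exact: lf_graph_countable.
have mbads : measurable (\bigcup_zj bad zj).
  exact: countable_bigcupT_measurable.
have bads0 : PM (\bigcup_zj bad zj) = 0%E.
  apply/eqP; rewrite eq_le measure_ge0 andbT.
  (* Constant 0 and empty [D] yield that a countable union of null events is null. *)
  have := @measure_countable_bigcup_le _ _ _ PM _ bad (fun=> set0) set0 0 ctbl.
  rewrite mul0e; apply => // [? ? _ _ [? [[]]]//|_|[z j]].
    exact: subset_refl.
  rewrite /bad /= probability_setC; last first.
    exact: measurable_walks_to.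
  by have [_ -> _] := fm_walkP M z j; rewrite subee.
have P_le m : (PM (survives M root) <= (mean * q ^+ m)%:E)%E.
  have mch := measurable_chains m [::] root m.
  apply: (@le_trans _ _ (PM (\bigcup_zj bad zj `|` chains m [::] root m))).
    apply: le_measure; rewrite ?inE;
      [exact: measurable_survives|exact: measurableU|].
    move=> w Sw; have [start|] := pselect (forall z j, walks_to z j 0 z w).
      by right; exact: survives_chains.
    move=> /existsNP[z /existsNP[j zj]]; left.
    by exists (z, j).
  apply: (le_trans (measureU2 _ mbads mch)).
  rewrite [X in (X + _)%E]bads0 add0e.
  have indT : indep_away [::] setT.
    have indM : mutually_independent PM input_events by exact: fm_indep.
    exact: indep_outsideS (@sub0set _ _) (indep_outsideT indM).
  have := prob_chains_le m m (isT : root \notin [::]) indT.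
  by rewrite setTI probability_setT mule1.
have PE : PM (survives M root) = (fine (PM (survives M root)))%:E.
  by rewrite fineK// fin_num_measure//; exact: measurable_survives.
apply/eqP; rewrite eq_le measure_ge0 andbT leNgt PE lte_fin.
apply/negP => P_gt0.
have : mean * q ^+ m @[m --> \oo] --> mean * 0.
  by apply: cvgMr; apply: cvg_expr; rewrite ger0_norm.
rewrite mulr0 => /cvgr_lt /(_ _ P_gt0)[m _ /(_ m (leqnn m))].
by rewrite ltNge -lee_fin -PE P_le.
Qed.

End activation_chains.

(** * The mean as a sum of tails, and the conclusion *)

Lemma tail_sum_expectation (R : realType) (d : measure_display)
    (T : measurableType d) (P : probability T R) (eta : {RV P >-> nat}) :
  (\sum_(0 <= i <oo) P [set w | (i < eta w)%N] =
   'E_P[fun w => (eta w)%:R : R])%E.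
Proof.
have mtail i : measurable [set w | (i < eta w)%N].
  rewrite -[X in measurable X]setTI.
  exact: (measurable_funP eta _ [set k | (i < k)%N]).
have -> : ('E_P[fun w => (eta w)%:R : R] = \int[P]_w (eta w)%:R%:E)%E.
  by rewrite unlock.
(* [eta w] counts the [i] below it; nonnegativity allows the exchange of sum and integral. *)
transitivity (\int[P]_w \sum_(0 <= i <oo)
    (\1_[set w | (i < eta w)%N] w)%:E)%E.
  rewrite integral_nneseries//; last first.
    by move=> i; apply/measurable_EFinP; exact: measurable_indic.
  by apply: eq_eseriesr => i _; rewrite integral_indic// setIT.
apply: eq_integral => w _.
rewrite (nneseries_split 0 (eta w))// add0n eseries0 ?adde0; last first.
  by move=> i ei _; rewrite indicE memNset//= ltnNge ei.
rewrite big_nat (eq_bigr (fun=> 1%E)); last first.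
  by move=> i /andP[_ ie]; rewrite indicE mem_set.
by rewrite -big_nat sumEFin big_const_nat subn0 iter_addr_0.
Qed.

Theorem proposition1p1 (R : realType) (d : measure_display)
    (T : measurableType d) (P : probability T R) (eta : {RV P >-> nat})
    (heta1 : (0 < P [set w | (1 <= eta w)%N])%E)
    (hmean : ('E_P[fun w => (eta w)%:R : R] < +oo)%E)
    (G : lf_graph) (root : site G) :
  (((fine 'E_P[fun w => (eta w)%:R : R] + 1)^-1)%:E
     <= critical_parameter root (distribution P eta))%E.
Proof.
apply: le_ereal_inf_tmp => _ [p [/andP[p0 _] [M survival_gt0]] <-].
have E_ge0 : (0 <= 'E_P[fun w => (eta w)%:R : R])%E.
  by apply: expectation_ge0 => w; exact: ler0n.
set mean := fine _; have mean_ge0 : 0 <= mean by exact: fine_ge0.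
have mean1_gt0 : 0 < mean + 1 by rewrite ltr_pwDr.
rewrite lee_fin leNgt; apply/negP => p_lt.
have q_lt1 : p * (1 + mean) < 1.
  by rewrite addrC -ltr_pdivlMr// mul1r.
have tail_le : (\sum_(0 <= i <oo) distribution P eta [set k | (i < k)%N]
    <= mean%:E)%E.
  (* By [hmean] the expectation is finite, so [fine] returns it and not the default 0. *)
  by rewrite [leLHS]tail_sum_expectation fineK// ge0_fin_numE.
by move: survival_gt0; rewrite (survives_null M p0 mean_ge0 tail_le)// ltxx.
Qed.
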